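(* Let $n\ge 3$, $s\ge 1$ and $m\ge 2s$ be integers. The eigenvalues of the adjacency matrix of the $s$-loose path $P^{(m)}_{L(s;n)}$, listed with multiplicity (coinciding values in the list add their multiplicities), are as follows. (1) If $m\ge 2s+1$: $\dfrac{-1}{m-1}$ with multiplicity $n(m-1)-2s(n-1)$, $\dfrac{-2}{m-1}$ with multiplicity $(n-1)(s-1)$, and $\dfrac{\alpha_i}{m-1}$ with multiplicity one for $i=1,2,\dots,2n-1$, where $\alpha_1,\dots,\alpha_{2n-1}$ are the zeros (with multiplicity) of the polynomial $$\frac{(m-s-1-x)^2f_1(x)+2s^2(1+x)(m-s-1-x)f_2(x)+s^4(1+x)^2f_3(x)}{m-2s-1-x},$$ where, for $j=1,2,3$, $$f_j(x)=\prod_{i=1}^{n-j}\Big\{x^2-\Big(m-3+2s\cos\frac{\pi i}{n-j+1}\Big)x-2\Big(m-s-1+s\cos\frac{\pi i}{n-j+1}\Big)\Big\}.$$ (2) If $m=2s$: $\dfrac{-1}{m-1}$ with multiplicity $2(s-1)$, $\dfrac{-2}{m-1}$ with multiplicity $(n-1)(s-1)$, and $\dfrac{\beta_i}{2s-1}$ with multiplicity one for $i=1,\dots,n+1$, where $\beta_1,\dots,\beta_{n+1}$ are the zeros (with multiplicity) of the polynomial $$(x-s+1)^2t_1(x)+2s^2(x-s+1)t_2(x)+s^4t_3(x),$$ where, for $j=1,2,3$, $t_j(x)=\prod_{i=1}^{n-j}\Big(2s-2-x+2s\cos\dfrac{\pi i}{n-j+1}\Big)$. Empty products are equal to $1$.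
   Context: The $s$-loose path $P^{(m)}_{L(s;n)}$ is the unweighted $m$-uniform hypergraph with vertex set $\{1,2,\dots,m+(n-1)(m-s)\}$ and with the $n$ edges $\{i(m-s)+1,i(m-s)+2,\dots,i(m-s)+m\}$, $i=0,1,\dots,n-1$. The adjacency matrix of an unweighted $m$-uniform hypergraph is the matrix indexed by its vertices with zero diagonal and with $(i,j)$ entry, for $i\ne j$, equal to $\frac{1}{m-1}$ times the number of edges containing both $i$ and $j$. *)

(* Defs.v *)
(* MathComp world, with MathComp-Analysis for the real numbers, cos and pi. *)
From HB Require Import structures.
From mathcomp Require Import all_boot all_order all_algebra zify.
From mathcomp Require Import reals trigo.

Set Implicit Arguments.
Unset Strict Implicit.
Unset Printing Implicit Defensive.

Import Order.TTheory GRing.Theory Num.Theory.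
Local Open Scope ring_scope.

Record uniform_hypergraph (N m : nat) := UniformHypergraph {
  hyperedges : {set {set 'I_N}};
  hyperedges_uniform : forall e, e \in hyperedges -> #|e| = m }.

Definition adjacency (R : realType) (N m : nat) (H : uniform_hypergraph N m) :
    'M[R]_N :=
  \matrix_(i, j)
    if i == j then 0
    else #|[set e in hyperedges H | (i \in e) && (j \in e)]|%:R / (m%:R - 1).

Section LoosePath.
Variables s m n : nat.

Definition loose_path_order : nat := (m + (n - 1) * (m - s))%N.

(* The element v of 'I_loose_path_order stands for the vertex v + 1. *)
Definition loose_path_edge (i : 'I_n) : {set 'I_loose_path_order} :=
  [set v : 'I_loose_path_order |
    (i * (m - s) + 1 <= v.+1 <= i * (m - s) + m)%N].

Definition loose_path_edges : {set {set 'I_loose_path_order}} :=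
  [set loose_path_edge i | i : 'I_n].

Lemma loose_path_edges_uniform e : e \in loose_path_edges -> #|e| = m.
Proof.
case/imsetP=> i _ ->.
have bnd (k : 'I_m) : (i * (m - s) + k < loose_path_order)%N.
  have := ltn_ord k; have := ltn_ord i; rewrite /loose_path_order => ni km.
  have : (i * (m - s) <= (n - 1) * (m - s))%N by rewrite leq_mul2r; lia.
  lia.
pose h k := Ordinal (bnd k).
have h_inj : injective h.
  by move=> k l /(congr1 val) /= /addnI kl; apply: val_inj.
rewrite -[RHS]card_ord -(card_codom h_inj); apply: eq_card => v.
rewrite inE; apply/idP/codomP => [/andP[lo hi] | [k ->]] /=; last first.
  by have := ltn_ord k; lia.
have vk : (v - i * (m - s) < m)%N by lia.
by exists (Ordinal vk); apply: val_inj => /=; lia.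
Qed.

Definition loose_path : uniform_hypergraph loose_path_order m :=
  UniformHypergraph loose_path_edges_uniform.

End LoosePath.

Section Spectrum.
Variable R : realType.

(* p splits over R and z lists its zeros, each as often as its multiplicity. *)
Definition zeros_with_mult (p : {poly R}) (z : seq R) : Prop :=
  p != 0 /\ p = lead_coef p *: \prod_(a <- z) ('X - a%:P).

Definition eigenvalues_with_mult (N : nat) (A : 'M[R]_N) (l : seq R) : Prop :=
  zeros_with_mult (char_poly A) l.

End Spectrum.

Section Polynomials.
Variables (R : realType) (s m n : nat).

(* For j = 1, 2, 3 and n >= 3 the subtraction n - j is not truncated. *)
Definition path_angle (j i : nat) : R := pi * i%:R / (n - j).+1%:R.

Definition f_poly (j : nat) : {poly R} :=
  \prod_(1 <= i < (n - j).+1)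
    ('X^2
     - (m%:R - 3 + 2 * s%:R * cos (path_angle j i)) *: 'X
     - (2 * (m%:R - s%:R - 1 + s%:R * cos (path_angle j i)))%:P).

Definition loose_numerator : {poly R} :=
  ((m%:R - s%:R - 1)%:P - 'X) ^+ 2 * f_poly 1
  + (2 * s%:R ^+ 2) *: ((1 + 'X) * ((m%:R - s%:R - 1)%:P - 'X) * f_poly 2)
  + (s%:R ^+ 4) *: ((1 + 'X) ^+ 2 * f_poly 3).

Definition loose_denominator : {poly R} := (m%:R - 2 * s%:R - 1)%:P - 'X.

Definition t_poly (j : nat) : {poly R} :=
  \prod_(1 <= i < (n - j).+1)
    ((2 * s%:R - 2)%:P - 'X + (2 * s%:R * cos (path_angle j i))%:P).

Definition half_overlap_polynomial : {poly R} :=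
  ('X - s%:R%:P + 1) ^+ 2 * t_poly 1
  + (2 * s%:R ^+ 2) *: (('X - s%:R%:P + 1) * t_poly 2)
  + (s%:R ^+ 4) *: t_poly 3.

End Polynomials.

(* Main.v *)
Require Import Defs.
From mathcomp Require Import all_boot all_order all_algebra.
From mathcomp Require Import reals trigo ring zify complex.

Set Implicit Arguments.
Unset Strict Implicit.
Unset Printing Implicit Defensive.

Import Order.TTheory GRing.Theory Num.Theory.
Local Open Scope ring_scope.

(** Let A be the adjacency matrix of the loose path, B its vertex-edge incidence
matrix and D the diagonal matrix of the vertex degrees.  Then
(m - 1) A = B B^T - D, so the characteristic polynomial of (m - 1) A is the
determinant of (x + D) - B B^T: a diagonal matrix perturbed by a matrix of rank
at most n.  Every degree d is 1 or 2, because edges at distance at least two are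
disjoint when m >= 2s, and hence (x + d)(x + 3 - d) = (x + 1)(x + 2) =: w does
not depend on the vertex.  Therefore x + 3 - D is, up to the factor w, an
inverse of x + D with polynomial entries, and [det_sub_mulmx] moves the
computation to the n x n matrix w - B^T (x + 3 - D) B.

Only consecutive edges meet, in s vertices, so this small matrix is tridiagonal
([reduced_matrix_tridiag]).  Its off-diagonal entries are - b for b = s (x + 1);
its diagonal entries are a = x^2 - (m - 3) x - 2 (m - s - 1), except that the two
end edges contribute a - s.  With U_k the determinant of the k x k tridiagonal
matrix with constant diagonal a and off-diagonal b, expansion at the two corners
gives (a - 2s) U_(n-1) + (s^2 - b^2) U_(n-2) = - (x + 2) Q, where
Q = (m - 1 - x) U_(n-1) + s^2 x U_(n-2).  Hence ([char_poly_core]) the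
characteristic polynomial of (m - 1) A, multiplied by w^n, is minus a product of
powers of x + 1 and x + 2 with Q.

It remains to recognise Q.  U_k is a homogenised Chebyshev polynomial of the
second kind, so it is the product of the a - 2 b cos (pi i / (k + 1))
([poly_continuant_prod]); thus f_j = U_(n-j), and the three-term recursion turns
the numerator of the theorem into (m - 2s - 1 - x) Q ([loose_numeratorE]).  When
m = 2s both a and b are divisible by x + 1; taking this factor out of U_k turns
f_j into t_j up to sign, and Q into (- (x + 1))^(n-2) times the polynomial of
part (2) ([half_overlap_core]).

That Q has all its zeros in R follows from the spectral theorem: after w^n is
cancelled, Q or its factor from part (2) divides the characteristic polynomial
of a symmetric real matrix.  The number of its zeros is then forced by the size
of that matrix ([spectrum_of_factor]). *)

(** * Determinants and characteristic polynomials *)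

(** A Sylvester determinant identity that avoids inverting E: both sides are the
determinant of the block matrix (E B; C 1) times w^n, whose top right block is
cleared either by row operations with the block 1 or by column operations with
E, after scaling the last n columns by w. *)
Lemma det_sub_mulmx (K : comNzRingType) N n (E E' : 'M[K]_N) (B : 'M_(N, n))
    (C : 'M_(n, N)) (w : K) :
  E *m E' = w%:M ->
  \det (E - B *m C) * w ^+ n = \det E * \det (w%:M - C *m E' *m B).
Proof.
move=> EE'.
have l1 : \det (block_mx E B C 1%:M) = \det (E - B *m C).
  have -> : block_mx E B C 1%:M =
      block_mx 1%:M B 0 1%:M *m block_mx (E - B *m C) 0 C 1%:M.
    by rewrite mulmx_block !mul1mx !mul0mx ?mulmx1 ?mulmx0 !add0r subrK.
  by rewrite det_mulmx det_ublock det_lblock !det1 !mul1r mulr1.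
have l2 : block_mx E B C 1%:M *m block_mx 1%:M (- (E' *m B)) 0 w%:M =
    block_mx E 0 C (w%:M - C *m E' *m B).
  rewrite mulmx_block !mulmx1 !mulmx0 !addr0 !mulmxN !mulmxA EE' mul1mx.
  by rewrite mul_scalar_mx mul_mx_scalar addNr addrC.
have := congr1 determinant l2.
by rewrite det_mulmx det_ublock det_lblock !det1 mul1r l1 det_scalar.
Qed.

Lemma char_poly_conj (K : fieldType) n (P A : 'M[K]_n) : P \in unitmx ->
  char_poly (invmx P *m A *m P) = char_poly A.
Proof.
move=> Pu; have Pd : map_mx polyC P \in unitmx.
  by rewrite unitmxE det_map_mx; apply: rmorph_unit; rewrite -unitmxE.
rewrite /char_poly /char_poly_mx !map_mxM /= map_invmx.
rewrite -[X in X - _](_ : invmx (map_mx polyC P) *m 'X%:M *m map_mx polyC P = _).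
  rewrite -mulmxBl -mulmxBr !det_mulmx mulrAC -det_mulmx mulVmx //.
  by rewrite det1 mul1r.
by rewrite -mulmxA mul_scalar_mx -scalemxAr mulVmx // scalemx1.
Qed.

(** Over the complex numbers A is unitarily diagonalisable, and a hermitian matrix
has real diagonal entries in its diagonal form. *)
Lemma symmetric_char_poly_split (R : rcfType) n (A : 'M[R]_n) :
  A^T = A -> exists z, char_poly A = \prod_(a <- z) ('X - a%:P).
Proof.
move=> Asym; pose rc := real_complex R; pose B := map_mx rc A.
have Bherm : B \is hermsymmx.
  apply: realsym_hermsym; last first.
    by apply/mxOverP => i j; rewrite mxE; apply/complex_realP; exists (A i j).
  by apply/is_hermitianmxP; rewrite expr0 scale1r map_mx_id // /B -{1}Asym map_trmx.
have /mxOverP Dreal := hermitian_spectral_diag_real Bherm.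
have /orthomx_spectralP BE := hermitian_normalmx Bherm.
exists [seq complex.Re (spectral_diag B 0 i) | i : 'I_n].
apply: (map_poly_inj (real_complex R)).
rewrite map_char_poly -/rc -/B {1}BE char_poly_conj ?spectral_unit //.
rewrite char_poly_trig ?diag_mx_is_trig // big_map big_enum /= rmorph_prod.
apply: eq_bigr => i _; rewrite mxE eqxx mulr1n rmorphB /= map_polyX map_polyC /=.
by rewrite RRe_real.
Qed.

(** Substituting c X for X in det (X - c A) gives c^n det (X - A). *)
Lemma char_poly_scale (K : fieldType) n (A : 'M[K]_n) c z : c != 0 ->
  char_poly (c *: A) = \prod_(a <- z) ('X - a%:P) ->
  char_poly A = \prod_(a <- [seq a / c | a <- z]) ('X - a%:P).
Proof.
move=> c0 H.
have szz : size z = n.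
  by have := size_char_poly (c *: A); rewrite H size_prod_XsubC => -[].
have E : char_poly (c *: A) \Po (c *: 'X) = c ^+ n *: char_poly A.
  rewrite /char_poly -det_map_mx /= -[c ^+ n *: _]mul_polyC polyC_exp -detZ.
  congr (\det _); apply/matrixP => i j; rewrite !mxE /=.
  rewrite rmorphB /= rmorphMn /= comp_polyX comp_polyC polyCM -mul_polyC.
  by rewrite mulrBr mulrnAr.
apply: (@scalerI _ _ (c ^+ n)); first by rewrite expf_neq0.
rewrite -E H rmorph_prod -szz big_map /=.
elim: z {H szz} => [|a z IH]; first by rewrite !big_nil expr0 scale1r.
rewrite !big_cons IH /= exprS rmorphB /= comp_polyX comp_polyC.
have -> : c *: 'X - a%:P = c *: ('X - (a / c)%:P) :> {poly K}.
  by rewrite scalerBr -!mul_polyC -polyCM mulrCA divff ?mulr1.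
by rewrite -scalerAl -scalerAr scalerA.
Qed.

Lemma dvdp_split (R : realType) (p : {poly R}) z : p != 0 ->
  p %| \prod_(a <- z) ('X - a%:P) -> exists y, zeros_with_mult p y.
Proof.
move=> p0 /dvdp_prod_XsubC[k]; move: (mask k z) => y py.
exists y; split=> //=; have /eqpP[[u v] /= /andP[u0 v0] uv] := py.
have pE : p = (v / u) *: \prod_(a <- y) ('X - a%:P).
  by apply: (scalerI u0); rewrite uv scalerA mulrCA divff ?mulr1.
suff -> : lead_coef p = v / u by [].
by rewrite pE lead_coefZ (monicP _) ?mulr1 // monic_prod_XsubC.
Qed.

(** * Tridiagonal determinants *)

Section Continuant.
Variable K : comNzRingType.

(** The determinant of the k x k tridiagonal matrix with diagonal entries a and
off-diagonal entries b; for b = 1 and a = 2 cos t it is the Chebyshev value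
sin ((k + 1) t) / sin t. *)
Fixpoint continuant (a b : K) (k : nat) : K :=
  if k is k'.+1 then
    if k' is k''.+1 then a * continuant a b k' - b ^+ 2 * continuant a b k''
    else a
  else 1.

Arguments continuant : simpl never.

Lemma continuantSS a b k : continuant a b k.+2 =
  a * continuant a b k.+1 - b ^+ 2 * continuant a b k.
Proof. by []. Qed.

Lemma two_step_ind (P : nat -> Prop) :
  P 0%N -> P 1%N -> (forall k, P k -> P k.+1 -> P k.+2) -> forall k, P k.
Proof.
move=> P0 P1 PS k; suff [] : P k /\ P k.+1 by [].
by elim: k => [//|k [Pk PSk]]; split=> //; apply: PS.
Qed.

Lemma continuantM c a b k :
  continuant (c * a) (c * b) k = c ^+ k * continuant a b k.
Proof.
elim/two_step_ind: k => [||k IH IHS]; rewrite ?expr0 ?mul1r //.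
by rewrite !continuantSS IH IHS !exprS; ring.
Qed.

Lemma continuantN a b k : continuant a (- b) k = continuant a b k.
Proof.
by elim/two_step_ind: k => [||k IH IHS] //; rewrite !continuantSS IH IHS sqrrN.
Qed.

Definition tridiag (d : nat -> K) (c : K) n : 'M_n :=
  \matrix_(i, j) if i == j :> nat then d i
    else if (i == j.+1 :> nat) || (j == i.+1 :> nat) then c else 0.

(** Laplace expansion along the first row, then along the first column of the
second minor. *)
Lemma det_tridiagSS d c n : \det (tridiag d c n.+2) =
  d 0%N * \det (tridiag (fun i => d i.+1) c n.+1)
  - c ^+ 2 * \det (tridiag (fun i => d i.+2) c n).
Proof.
rewrite (expand_det_row _ ord0) !big_ord_recl big1 => [|i _]; last first.
  by rewrite mxE /= mul0r.
rewrite addr0 !mxE /= /cofactor /= !add0n expr0 mul1r expr1.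
congr (_ * \det _ + _).
  by apply/matrixP => i j; rewrite !mxE.
rewrite (expand_det_col _ ord0) big_ord_recl big1 => [|i _]; last first.
  by rewrite !mxE /= mul0r.
rewrite !mxE /= /cofactor /= expr0 mul1r addr0 mulN1r mulrN expr2 mulrA.
congr (- (_ * \det _)).
by apply/matrixP => i j; rewrite !mxE.
Qed.

(** The determinant is affine in the last diagonal entry; the subtracted e
multiplies the complementary minor. *)
Lemma det_tridiag_last a c e k :
  \det (tridiag (fun i => if i == k then a - e else a) c k.+1) =
  continuant a c k.+1 - e * continuant a c k.
Proof.
elim/two_step_ind: k => [||k IH IHS].
- by rewrite det_mx11 mxE /= -[RHS]/(a - e * 1) mulr1.
- rewrite det_tridiagSS det_mx11 det_mx00 mxE continuantSS /=.
  by rewrite -[continuant a c 1]/a -[continuant a c 0]/(1 : K); ring.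
- rewrite det_tridiagSS /= IH IHS !continuantSS; ring.
Qed.

(** Subtracting e at both corners would give U_n - 2 e U_(n-1) + e^2 U_(n-2); the
recursion removes U_n, which exceeds the sizes occurring in the theorem. *)
Lemma det_tridiag_corners a c e n : (3 <= n)%N ->
  \det (tridiag (fun i => if (i == 0) || (i == n.-1) then a - e else a) c n) =
  (a - e *+ 2) * continuant a c (n - 1)
  + (e ^+ 2 - c ^+ 2) * continuant a c (n - 2).
Proof.
case: n => [|[|[|k]]] // _; rewrite det_tridiagSS subn1 subn2 /=.
rewrite (det_tridiag_last a c e k.+1) (det_tridiag_last a c e k) !continuantSS.
ring.
Qed.

End Continuant.

Lemma rmorph_continuant (K L : comNzRingType) (f : {rmorphism K -> L}) a b k :
  f (continuant a b k) = continuant (f a) (f b) k.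
Proof.
elim/two_step_ind: k => [||k IH IHS]; rewrite ?rmorph1 //.
by rewrite !continuantSS rmorphB 2!rmorphM rmorphXn /= IH IHS.
Qed.

(** * Continuants as products of cosines *)

Lemma poly_eq_horner (K : numDomainType) (p q : {poly K}) :
  (forall x, p.[x] = q.[x]) -> p = q.
Proof.
move=> pq; apply/eqP; rewrite -subr_eq0; apply/eqP.
apply: (@roots_geq_poly_eq0 _ _ [seq i%:R | i <- iota 0 (size (p - q))]).
- by apply/allP => x _; rewrite rootE !hornerE pq subrr.
- by rewrite map_inj_uniq ?iota_uniq //; apply: (mulrIn (oner_neq0 K)).
- by rewrite size_map size_iota.
Qed.

Section Chebyshev.
Variable R : realType.

Lemma size_monic_continuantX k (p := continuant ('X : {poly R}) 1 k) :
  size p = k.+1 /\ p \is monic.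
Proof.
rewrite /p; elim/two_step_ind: k {p} => [||k [sz mon] [szS monS]].
- by rewrite size_poly1 monic1.
- by rewrite size_polyX monicX.
rewrite continuantSS expr1n mul1r mulrC.
have sX : size (continuant ('X : {poly R}) 1 k.+1 * 'X) = k.+3.
  by rewrite size_mulX ?szS // monic_neq0.
split; first by rewrite size_polyDl sX // size_polyN sz.
by rewrite monicE lead_coefDl ?sX ?size_polyN ?sz // lead_coefMX -monicE.
Qed.

(** By induction: sin ((k + 3) t) = 2 cos t sin ((k + 2) t) - sin ((k + 1) t). *)
Lemma sin_continuant (t : R) k :
  sin t * continuant (2 * cos t) 1 k = sin (k.+1%:R * t).
Proof.
elim/two_step_ind: k => [||k IH IHS].
- by rewrite mulr1 mul1r.
- by rewrite -[continuant _ _ 1]/(2 * cos t) [2 * t]mulr_natl mulr2n sinD; ring.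
rewrite continuantSS expr1n mul1r mulrBr mulrCA IH IHS.
have -> : k.+3%:R * t = k.+2%:R * t + t by rewrite -[k.+3]addn1 natrD; ring.
have -> : k.+1%:R * t = k.+2%:R * t - t by rewrite -[k.+2]addn1 natrD; ring.
by rewrite sinB sinD; ring.
Qed.

Lemma sin_pi_natr i : sin (pi * i%:R : R) = 0.
Proof.
elim: i => [|i IH]; first by rewrite mulr0 sin0.
by rewrite -[i.+1]addn1 natrD mulrDr mulr1 sinDpi IH oppr0.
Qed.

(** The k numbers 2 cos (pi i / (k + 1)) are zeros by [sin_continuant], and they are
distinct because cos is injective on [0, pi]; the degree is k. *)
Lemma continuantX_prod k : continuant ('X : {poly R}) 1 k =
  \prod_(1 <= i < k.+1) ('X - (2 * cos (pi * i%:R / k.+1%:R))%:P).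
Proof.
have [sz mon] := size_monic_continuantX k.
pose t i : R := pi * i%:R / k.+1%:R.
have k0 : (0 : R) < k.+1%:R by rewrite ltr0n.
have t_itv i : (1 <= i < k.+1)%N -> 0 < t i < pi.
  case/andP=> i1 ik; rewrite /t divr_gt0 ?mulr_gt0 ?pi_gt0 ?ltr0n //=.
  by rewrite ltr_pdivrMr // ltr_pM2l ?pi_gt0 // ltr_nat.
rewrite -(big_map (fun i => 2 * cos (t i)) predT (fun x => 'X - x%:P)).
rewrite [LHS](@all_roots_prod_XsubC _ _
  [seq 2 * cos (t i) | i <- index_iota 1 k.+1]).
- by rewrite (monicP mon) scale1r.
- by rewrite sz size_map size_iota subn1.
- rewrite all_map; apply/allP => i; rewrite mem_index_iota => /t_itv ti /=.
  rewrite rootE -horner_evalE rmorph_continuant /= !horner_evalE hornerX hornerC.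
  have := sin_continuant (t i) k.
  rewrite [k.+1%:R * _]mulrC divfK ?(gt_eqF k0) // sin_pi_natr.
  by move/eqP; rewrite mulf_eq0 (gt_eqF (sin_gt0_pi ti)).
have two0 : (2 : R) != 0 by rewrite pnatr_eq0.
have kV0 : (k.+1%:R^-1 : R) != 0 by rewrite invr_eq0 gt_eqF.
have pi0 : (pi : R) != 0 by rewrite gt_eqF ?pi_gt0.
rewrite uniq_rootsE map_inj_in_uniq ?iota_uniq // => i j.
rewrite !mem_index_iota => /t_itv/andP[i0 i1] /t_itv/andP[j0 j1].
move=> /(mulfI two0)/cos_inj; rewrite !in_itv /= !ltW // => /(_ isT isT).
by move=> /(mulIf kV0)/(mulfI pi0)/eqP; rewrite eqr_nat => /eqP.
Qed.

(** Homogenisation of [continuantX_prod]: for b <> 0 evaluate it at a / b, and for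
b = 0 both sides are a^k. *)
Lemma continuant_prod (a b : R) k : continuant a b k =
  \prod_(1 <= i < k.+1) (a - 2 * b * cos (pi * i%:R / k.+1%:R)).
Proof.
have [-> | b0] := eqVneq b 0.
  rewrite (eq_bigr (fun=> a)) => [|i _]; last by ring.
  rewrite big_const_nat iter_mulr_1 subn1 /=.
  elim/two_step_ind: k => [||k IH IHS] //.
  by rewrite continuantSS IHS expr0n /= mul0r subr0 -exprS.
have -> : continuant a b k = b ^+ k * (continuant 'X 1 k).[a / b].
  rewrite -horner_evalE rmorph_continuant /= !horner_evalE hornerX hornerC.
  by rewrite -continuantM mulr1 mulrCA divff ?mulr1.
rewrite continuantX_prod horner_prod.
have -> : b ^+ k = \prod_(1 <= i < k.+1) b by rewrite prodr_const_nat subn1.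
rewrite -big_split /=; apply: eq_bigr => i _.
by rewrite !hornerE mulrBr mulrCA divff // mulr1; ring.
Qed.

Lemma poly_continuant_prod (a b : {poly R}) k : continuant a b k =
  \prod_(1 <= i < k.+1) (a - (2 * cos (pi * i%:R / k.+1%:R)) *: b).
Proof.
apply: poly_eq_horner => x; rewrite horner_prod.
rewrite -horner_evalE rmorph_continuant /= !horner_evalE continuant_prod.
by apply: eq_bigr => i _; rewrite !hornerE; ring.
Qed.
End Chebyshev.

(** * Incidences of the loose path *)

Lemma sum_ord_eqn n c : (\sum_(k < n) (k == c :> nat) = (c < n))%N.
Proof.
have [cn | nc] := ltnP c n; last first.
  by rewrite big1 // => k _; have := ltn_ord k; lia.
rewrite (bigD1 (Ordinal cn)) //= eqxx big1 // => k.
by rewrite -val_eqE /= => /negPf->.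
Qed.

Lemma sum_ord_interval N lo hi : (hi <= N)%N ->
  (\sum_(v < N) (lo <= v < hi) = hi - lo)%N.
Proof.
elim: N hi => [|N IH] hi hiN; first by rewrite big_ord0; lia.
rewrite big_ord_recr /=; have [hiN' | Nhi] := leqP hi N.
  by rewrite IH //; lia.
rewrite (eq_bigr (fun v : 'I_N => (lo <= v < N)%N : nat)) => [|v _].
  by rewrite IH //; lia.
by have := ltn_ord v; lia.
Qed.

Section LoosePathCounting.
Variables s m n : nat.
Hypotheses (hn : (0 < n)%N) (hs : (1 <= s)%N) (hm : (2 * s <= m)%N).
Local Notation N := (loose_path_order s m n).
Local Notation edge := (@loose_path_edge s m n).

Lemma in_loose_path_edge (v : 'I_N) (i : 'I_n) :
  (v \in edge i) = (i * (m - s) <= v < i * (m - s) + m)%N.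
Proof. by rewrite inE; lia. Qed.

Definition vertex_degree (v : 'I_N) : nat := (\sum_(i < n) (v \in edge i))%N.

Lemma edge_end_le (i : 'I_n) : (i * (m - s) + m <= N)%N.
Proof.
rewrite /loose_path_order addnC leq_add2l leq_mul2r.
by have := ltn_ord i; lia.
Qed.

(** Edges are intervals of length m whose origins are m - s apart, so they meet in
m - |i - j| (m - s) vertices, truncated at 0; for |i - j| >= 2 this vanishes
since 2 (m - s) >= m. *)
Lemma card_edgeI (i j : 'I_n) :
  (\sum_(v < N) (v \in edge i) * (v \in edge j))%N =
  if i == j then m else if (i == j.+1 :> nat) || (j == i.+1 :> nat) then s else 0%N.
Proof.
wlog ij : i j / (i <= j)%N => [H|].
  have [ij | /ltnW ji] := leqP i j; first exact: H.
  rewrite (eq_sym i) orbC -H //; apply: eq_bigr => v _; exact: mulnC.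
have ijM : (i * (m - s) <= j * (m - s))%N by rewrite leq_mul2r ij orbT.
rewrite (eq_bigr (fun v : 'I_N =>
  (j * (m - s) <= v < i * (m - s) + m)%N : nat)) => [|v _]; last first.
  by rewrite !in_loose_path_edge mulnb; lia.
rewrite sum_ord_interval ?edge_end_le // -val_eqE.
have [ji | ne] := eqVneq (i : nat) j; first by rewrite ji; lia.
have [E | ji] := eqVneq (j : nat) i.+1; first by rewrite orbT E mulSn; lia.
rewrite orbF (ltn_eqF (_ : i < j.+1)%N) //.
have : ((i.+2) * (m - s) <= j * (m - s))%N by rewrite leq_mul2r; lia.
by rewrite !mulSn; lia.
Qed.

(** With q = m - s, a vertex v lies in the edge numbered v / q, or in the last edge
when v / q is too large, and only the edges numbered v / q and v / q - 1 can
contain it. *)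
Lemma vertex_degree_bounds v : (1 <= vertex_degree v <= 2)%N.
Proof.
have q0 : (0 < m - s)%N by lia.
have vq := leq_trunc_div v (m - s); have vq' := ltn_ceil v q0.
apply/andP; split.
  have vN : (v < m + n.-1 * (m - s))%N by rewrite -subn1; apply: ltn_ord.
  have i_n : (minn (v %/ (m - s)) n.-1 < n)%N by lia.
  suff vi : (minn (v %/ (m - s)) n.-1 * (m - s) <= v
             < minn (v %/ (m - s)) n.-1 * (m - s) + m)%N.
    by rewrite /vertex_degree (bigD1 (Ordinal i_n)) //= in_loose_path_edge vi.
  have [le | /ltnW le] := leqP (v %/ (m - s)) n.-1.
    by rewrite vq; move: vq'; rewrite mulSn; lia.
  have : (n.-1 * (m - s) <= v %/ (m - s) * (m - s))%N by rewrite leq_mul2r le orbT.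
  lia.
rewrite /vertex_degree.
apply: (@leq_trans (\sum_(i < n) ((i == v %/ (m - s) :> nat) +
                                  (i == (v %/ (m - s)).-1 :> nat)))).
  apply: leq_sum => i _; rewrite in_loose_path_edge.
  have [/andP[lo hi] | //] := boolP (_ <= v < _)%N.
  have i1 : (i <= v %/ (m - s))%N by rewrite leq_divRL.
  have i2 : (v %/ (m - s) < i.+2)%N by rewrite ltn_divLR // !mulSn; lia.
  lia.
by rewrite big_split /= !sum_ord_eqn; lia.
Qed.

Lemma vertex_degree_eq2 v (i j : 'I_n) :
  i != j -> v \in edge i -> v \in edge j -> vertex_degree v = 2.
Proof.
move=> ij vi vj; apply/eqP; rewrite eqn_leq.
have /andP[_ -> /=] := vertex_degree_bounds v.
by rewrite /vertex_degree (bigD1 i) // (bigD1 j) 1?eq_sym //= vi vj.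
Qed.

Lemma sum_vertex_degree : (\sum_(v < N) vertex_degree v = n * m)%N.
Proof.
rewrite exchange_big /= -[n in RHS]card_ord -sum_nat_const.
apply: eq_bigr => i _; have := card_edgeI i i; rewrite eqxx; apply: etrans.
by apply: eq_bigr => v _; case: (v \in _).
Qed.

(** Exchanging the sums, this adds up the intersections of edge i with all edges:
m with itself and s with each neighbour. *)
Lemma sum_edge_degree (i : 'I_n) :
  (\sum_(v < N) (v \in edge i) * vertex_degree v = m + s * ((0 < i) + (i < n.-1)))%N.
Proof.
under eq_bigr do rewrite big_distrr /=.
rewrite exchange_big /=.
under eq_bigr do rewrite card_edgeI.
rewrite (eq_bigr (fun k : 'I_n => m * (k == i :> nat) +
  s * ((k == i.-1 :> nat) && (0 < i) + (k == i.+1 :> nat))))%N => [|k _]; last first.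
  rewrite -val_eqE /=.
  have -> : (k == i.-1 :> nat) && (0 < i)%N = (i == k.+1 :> nat) by lia.
  have [ik | ik] := eqVneq (i : nat) k; first by rewrite ik; lia.
  by case: eqP => ?; case: eqP => ? /=; rewrite ?muln0 ?muln1 //; lia.
rewrite big_split /= -!big_distrr /= big_split /=.
rewrite !sum_ord_eqn ltn_ord muln1.
have [i0 | i0] := posnP i; first by rewrite i0 big1 // => [|k _]; lia.
by under eq_bigr do rewrite andbT; rewrite sum_ord_eqn; have := ltn_ord i; lia.
Qed.

Lemma loose_path_edge_inj : injective edge.
Proof.
have H (i j : 'I_n) : (i < j)%N -> edge i <> edge j.
  move=> ij eij.
  have iN : (i * (m - s) < N)%N by have := edge_end_le i; lia.
  have : Ordinal iN \in edge i by rewrite in_loose_path_edge /=; lia.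
  rewrite eij in_loose_path_edge /=.
  have : (i.+1 * (m - s) <= j * (m - s))%N by rewrite leq_mul2r ij orbT.
  by rewrite mulSn; lia.
move=> i j eij; apply: val_inj; case: (ltngtP i j) => // /H; first by [].
by move/nesym.
Qed.

Lemma card_common_edges (u v : 'I_N) :
  #|[set e in loose_path_edges s m n | (u \in e) && (v \in e)]| =
  (\sum_(i < n) (u \in edge i) * (v \in edge i))%N.
Proof.
have -> : [set e in loose_path_edges s m n | (u \in e) && (v \in e)] =
    edge @: [set i | (u \in edge i) && (v \in edge i)].
  apply/setP => e; rewrite in_set; apply/andP/imsetP.
    by case=> /imsetP[i _ ->] uv; exists i; rewrite // in_set.
  by case=> i; rewrite in_set => uv ->; rewrite imset_f.
rewrite card_imset; last exact: loose_path_edge_inj.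
rewrite -sum1_card big_mkcond /=; apply: eq_bigr => i _.
by rewrite in_set mulnb; case: (_ && _).
Qed.

End LoosePathCounting.

(** * The characteristic polynomial *)

Lemma prod_degree_one_two (K : comNzRingType) (I : finType) (x : K) (d : I -> nat) :
  (forall i, 1 <= d i <= 2)%N ->
  \prod_i (x + (d i)%:R) = (x + 1) ^+ (2 * #|I| - \sum_i d i) *
                           (x + 2) ^+ (\sum_i d i - #|I|).
Proof.
move=> d12.
have sub : (\sum_i d i - #|I| = \sum_i (d i - 1))%N.
  rewrite -sum1_card -sumnB // => i _; by case/andP: (d12 i).
have sub2 : (2 * #|I| - \sum_i d i = \sum_i (2 - d i))%N.
  rewrite mulnC -sum_nat_const -sumnB // => i _; by case/andP: (d12 i).
rewrite sub sub2 !expr_sum -big_split /=; apply: eq_bigr => i _.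
by case/andP: (d12 i); case: (d i) => [|[|[|]]] //= _ _;
  rewrite expr0 expr1 ?mulr1 ?mul1r.
Qed.

Section CharPoly.
Variables (R : realType) (s m n : nat).
Hypotheses (hn : (1 < n)%N) (hs : (1 <= s)%N) (hm : (2 * s <= m)%N).
Local Notation N := (loose_path_order s m n).
Local Notation edge := (@loose_path_edge s m n).
Local Notation deg := (@vertex_degree s m n).
Local Notation P := {poly R}.

(** The diagonal entry of the reduced matrix at an edge with two neighbours. *)
Definition inner_diag : P :=
  'X ^+ 2 - (m%:R - 3) * 'X - 2 * (m%:R - s%:R - 1).
Definition link : P := s%:R * ('X + 1).

Let incidence : 'M[P]_(N, n) := \matrix_(v, i) (v \in edge i)%:R.
Let shifted_degrees : 'M[P]_N := diag_mx (\row_v ('X + (deg v)%:R)).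
Let codegrees : 'M[P]_N := diag_mx (\row_v ('X + 3 - (deg v)%:R)).

(** For d = 1 and for d = 2 the product (X + d) (X + 3 - d) is the same. *)
Lemma mul_degrees :
  shifted_degrees *m codegrees = (('X + 1) * ('X + 2))%:M.
Proof.
apply/matrixP => i j; rewrite mul_diag_mx !mxE.
have [_|_] := eqVneq i j; last by rewrite !mulr0n mulr0.
rewrite !mulr1n; have /andP[] := @vertex_degree_bounds s m n (ltnW hn) hs hm i.
by case: (deg i) => [|[|[|]]] // _ _; ring.
Qed.

Lemma char_poly_incidence :
  char_poly ((m%:R - 1) *: adjacency R (loose_path s m n)) =
  \det (shifted_degrees - incidence *m incidence^T).
Proof.
have m1 : (m%:R - 1 : R) != 0.
  by rewrite subr_eq0 pnatr_eq1; lia.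
congr (\det _); apply/matrixP => u v; rewrite !mxE.
rewrite (eq_bigr (fun i => ((u \in edge i) * (v \in edge i))%:R)) => [|i _]; last first.
  by rewrite !mxE natrM.
rewrite -natr_sum.
have [<-|uv] := eqVneq u v.
  rewrite !mulr1n mulr0 polyC0 subr0 /vertex_degree.
  under [X in _ - X%:R]eq_bigr do rewrite mulnb andbb.
  by rewrite addrK.
rewrite !mulr0n !sub0r mulrC divfK // card_common_edges //; last exact: ltnW.
by rewrite polyC_natr.
Qed.

(** On the diagonal, the sum of X + 3 - deg v over the edge is evaluated by
[sum_edge_degree]; off the diagonal, the common vertices of two edges have degree
2 and contribute X + 1 each. *)
Lemma reduced_matrix_tridiag :
  (('X + 1) * ('X + 2))%:M - incidence^T *m codegrees *m incidence =
  tridiag (fun i => if (i == 0) || (i == n.-1) then inner_diag - s%:R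
                    else inner_diag) (- link) n.
Proof.
apply/matrixP => i j; rewrite mul_mx_diag !mxE.
have [ij | ij] := eqVneq (i : nat) j.
  have {ij} <- : i = j by apply: val_inj.
  rewrite eqxx mulr1n.
  rewrite (eq_bigr (fun v => ('X + 3) * ((v \in edge i) * (v \in edge i))%:R
             - ((v \in edge i) * deg v)%:R)) => [|v _]; last first.
    by rewrite !mxE !natrM; case: (v \in _) => /=; ring.
  rewrite big_split /= sumrN -big_distrr /= -!natr_sum.
  rewrite card_edgeI ?(ltnW hn) // eqxx sum_edge_degree ?(ltnW hn) //.
  rewrite /inner_diag natrD natrM natrD.
  have -> : (i < n.-1)%N = ((i : nat) != n.-1) by have := ltn_ord i; lia.
  rewrite lt0n; have [i0 | i0] := eqVneq (i : nat) 0;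
    have [i1 | i1] := eqVneq (i : nat) n.-1 => /=.
  - by move: i1; rewrite i0; lia.
  - by ring.
  - by ring.
  - by ring.
rewrite -val_eqE (negPf ij) mulr0n sub0r.
rewrite (eq_bigr (fun v => ('X + 1) * ((v \in edge i) * (v \in edge j))%:R))
  => [|v _]; last first.
  rewrite !mxE; have [vi|] := boolP (v \in edge i); last by rewrite !mul0r mulr0.
  have [vj|] := boolP (v \in edge j); last by rewrite !mulr0.
  by rewrite (vertex_degree_eq2 (ltnW hn) hs hm _ vi vj) //; ring.
rewrite -big_distrr /= -natr_sum card_edgeI ?(ltnW hn) // -val_eqE (negPf ij).
by case: (_ || _); rewrite /link ?mulr0 ?oppr0 //; ring.
Qed.

(** Minus the determinant of the reduced matrix, divided by X + 2. *)
Definition core_poly : P :=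
  (m%:R - 1 - 'X) * continuant inner_diag link (n - 1)
  + s%:R ^+ 2 * 'X * continuant inner_diag link (n - 2).

(** The multiplicities of degree 1 and degree 2 among the N vertices: the degrees
take only these values and add up to n m. *)
Lemma degree_multiplicities :
  (2 * N - n * m = n * (m - 2 * s) + 2 * s)%N /\
  (n * m - N = (n - 1) * s)%N.
Proof.
rewrite /loose_path_order; case: n hn => // k _.
have [r ->] : exists r, m = (2 * s + r)%N by exists (m - 2 * s)%N; lia.
have -> : (2 * s + r - s = s + r)%N by lia.
by rewrite addKn subn1 /=; split; nia.
Qed.

(** The factor w^n stays on the left because n can exceed the number of vertices of
degree 1 (when m = 2s) or of degree 2 (when s = 1); the missing powers of X + 1
come from [core_poly], that of X + 2 from the corner determinant. *)
Lemma char_poly_core : (2 < n)%N ->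
  char_poly ((m%:R - 1) *: adjacency R (loose_path s m n))
    * (('X + 1) * ('X + 2)) ^+ n =
  - (('X + 1) ^+ (n * (m - 2 * s) + 2 * s) * ('X + 2) ^+ ((n - 1) * s).+1
     * core_poly).
Proof.
move=> n2; have [e1 e2] := degree_multiplicities.
rewrite char_poly_incidence (det_sub_mulmx _ _ mul_degrees) reduced_matrix_tridiag.
rewrite det_tridiag_corners // !continuantN sqrrN.
rewrite det_diag; under eq_bigr do rewrite mxE.
rewrite prod_degree_one_two; last exact: vertex_degree_bounds (ltnW hn) hs hm.
rewrite sum_vertex_degree ?(ltnW hn) // card_ord e1 e2.
rewrite [('X + 2) ^+ _.+1]exprSr /core_poly.
move: (('X + 1) ^+ _) (('X + 2) ^+ _) (continuant _ _ _) (continuant _ _ _).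
move=> p1 p2 c1 c2; rewrite /inner_diag /link; ring.
Qed.

End CharPoly.

(** * Identification of the zeros *)

(** A symmetric matrix has a split characteristic polynomial, hence so has its
factor p, and the number d of zeros of p is what remains of the size N. *)
Lemma spectrum_of_factor (R : realType) N (A : 'M[R]_N) (p : {poly R})
    (c mu : R) k1 k2 d :
  A^T = A -> mu != 0 -> c != 0 -> N = (k1 + k2 + d)%N ->
  char_poly (mu *: A) = c *: (('X + 1) ^+ k1 * ('X + 2) ^+ k2 * p) ->
  exists y : d.-tuple R, zeros_with_mult p y /\
    eigenvalues_with_mult A
      (nseq k1 (- 1 / mu) ++ nseq k2 (- 2 / mu) ++ [seq a / mu | a <- y]).
Proof.
move=> Asym mu0 c0 Nd charE.
have X1 : 'X + 1 = 'X - (-1)%:P :> {poly R} by rewrite polyCN opprK.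
have X2 : 'X + 2 = 'X - (-2)%:P :> {poly R} by rewrite polyCN opprK polyC_natr.
set r := nseq k1 (-1) ++ nseq k2 (-2) : seq R.
have rE : ('X + 1) ^+ k1 * ('X + 2) ^+ k2 = \prod_(a <- r) ('X - a%:P).
  by rewrite big_cat !big_nseq !iter_mulr_1 X1 X2.
have [z zE] : exists z, char_poly (mu *: A) = \prod_(a <- z) ('X - a%:P).
  by apply: symmetric_char_poly_split; rewrite linearZ /= Asym.
have p0 : p != 0.
  apply: contraTneq (char_poly_monic (mu *: A)) => p0.
  by rewrite charE p0 mulr0 scaler0 monicE lead_coef0 eq_sym oner_eq0.
have pz : p %| \prod_(a <- z) ('X - a%:P).
  by rewrite -zE charE dvdpZr // dvdp_mull.
have [y yp] := dvdp_split p0 pz.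
have charE' : char_poly (mu *: A) = \prod_(a <- r ++ y) ('X - a%:P).
  have [_ pE] := yp; rewrite big_cat /= -rE.
  have /monicP := char_poly_monic (mu *: A).
  have mon : \prod_(a <- r) ('X - a%:P) * \prod_(a <- y) ('X - a%:P) \is monic.
    by rewrite -big_cat monic_prod_XsubC.
  move: charE; rewrite pE -scalerAr scalerA rE => ->.
  by rewrite lead_coefZ (monicP mon) mulr1 => ->; rewrite scale1r.
have yd : size y == d.
  have := size_char_poly (mu *: A).
  rewrite charE' size_prod_XsubC !size_cat !size_nseq Nd => -[].
  by move/addnI->.
exists (Tuple yd); split=> //.
split; first by rewrite monic_neq0 ?char_poly_monic.
rewrite (monicP (char_poly_monic _)) scale1r (char_poly_scale mu0 charE').
by rewrite !map_cat !map_nseq catA.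
Qed.

Definition polyC_simp (R : nzRingType) :=
  (@polyCB R, @polyCD R, @polyCM R, @polyCN R, @polyC_exp R, @polyC_natr R,
   @polyC1 R).

Lemma f_polyE (R : realType) s m n j :
  f_poly R s m n j = continuant (inner_diag R s m) (link R s) (n - j).
Proof.
rewrite poly_continuant_prod; apply: eq_bigr => i _.
rewrite /path_angle /inner_diag /link; set t := cos _.
by rewrite -!mul_polyC !polyC_simp; ring.
Qed.

Lemma t_polyE (R : realType) s n j :
  t_poly R s n j = continuant (2 * s%:R - 2 - 'X : {poly R}) s%:R (n - j).
Proof.
rewrite -continuantN poly_continuant_prod; apply: eq_bigr => i _.
rewrite /path_angle; set t := cos _.
by rewrite -!mul_polyC !polyC_simp; ring.
Qed.

(** Under the recursion f_1 = a f_2 - b^2 f_3 the numerator is a combination of f_1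
and f_2 whose two coefficients are multiples of the denominator. *)
Lemma loose_numeratorE (R : realType) s m n : (3 <= n)%N ->
  loose_numerator R s m n = core_poly R s m n * loose_denominator R s m.
Proof.
case: n => [|[|[|k]]] // _.
rewrite /loose_numerator /loose_denominator /core_poly !f_polyE.
rewrite !subSS !subn0 continuantSS /inner_diag /link.
rewrite -!mul_polyC.
rewrite !polyC_simp.
by ring.
Qed.

(** For m = 2s the entries are a = - (X + 1) (2s - 2 - X) and b = s (X + 1), so by
homogeneity every continuant contains a power of - (X + 1). *)
Lemma half_overlap_core (R : realType) s n : (3 <= n)%N ->
  core_poly R s (2 * s) n =
  (- ('X + 1)) ^+ (n - 2) * half_overlap_polynomial R s n.
Proof.
case: n => [|[|[|k]]] // _.
rewrite /half_overlap_polynomial /core_poly !t_polyE.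
have -> : inner_diag R s (2 * s) = - ('X + 1) * (2 * s%:R - 2 - 'X).
  by rewrite /inner_diag natrM; ring.
have -> : link R s = - (- ('X + 1) * s%:R) by rewrite /link; ring.
rewrite !continuantN !continuantM !subSS !subn0 !continuantSS.
rewrite -!mul_polyC.
rewrite !polyC_simp natrM exprS.
by ring.
Qed.

Lemma adjacency_sym (R : realType) N m (H : uniform_hypergraph N m) :
  (adjacency R H)^T = adjacency R H.
Proof.
apply/matrixP => i j; rewrite !mxE eq_sym; case: eqP => // _.
by congr (_%:R / _); apply: eq_card => e; rewrite !inE [(j \in e) && _]andbC.
Qed.

Theorem theorem4p2p3 (R : realType) (n s m : nat)
    (hn : (3 <= n)%N) (hs : (1 <= s)%N) (hm : (2 * s <= m)%N) :
  ((2 * s + 1 <= m)%N ->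
     loose_denominator R s m %| loose_numerator R s m n /\
     exists alpha : (2 * n - 1).-tuple R,
       zeros_with_mult
         (loose_numerator R s m n %/ loose_denominator R s m) alpha /\
       eigenvalues_with_mult (adjacency R (loose_path s m n))
         (nseq (n * (m - 1) - 2 * s * (n - 1)) (- 1 / (m%:R - 1))
          ++ nseq ((n - 1) * (s - 1)) (- 2 / (m%:R - 1))
          ++ [seq a / (m%:R - 1) | a <- alpha])) /\
  (m = (2 * s)%N ->
     exists beta : (n + 1).-tuple R,
       zeros_with_mult (half_overlap_polynomial R s n) beta /\
       eigenvalues_with_mult (adjacency R (loose_path s m n))
         (nseq (2 * (s - 1)) (- 1 / (m%:R - 1))
          ++ nseq ((n - 1) * (s - 1)) (- 2 / (m%:R - 1))
          ++ [seq b / (2 * s%:R - 1) | b <- beta])).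
Proof.
have m1 : (m%:R - 1 : R) != 0 by rewrite subr_eq0 pnatr_eq1; lia.
have w0 : (('X + 1) * ('X + 2) : {poly R}) ^+ n != 0.
  rewrite expf_neq0 // mulf_neq0 // -?polyC_natr -size_poly_eq0.
    by rewrite size_XaddC.
  by rewrite size_XaddC.
(* Both parts cancel w^n from this identity, n powers of X + 1 and of X + 2. *)
have core := char_poly_core R (ltnW hn) hs hm hn.
have sym := adjacency_sym R (loose_path s m n).
split=> [hm1 | hm0].
  have den0 : loose_denominator R s m != 0.
    by rewrite -size_poly_eq0 /loose_denominator -opprB size_polyN size_XsubC.
  rewrite loose_numeratorE // dvdp_mull //; split=> //; rewrite mulpK //.
  apply: (spectrum_of_factor sym m1 (c := -1)).
  - by rewrite oppr_eq0 oner_eq0.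
  - by rewrite /loose_path_order; nia.
  apply: (mulIf w0); rewrite core scaleN1r mulNr exprMn.
  have -> : (n * (m - 2 * s) + 2 * s = n * (m - 1) - 2 * s * (n - 1) + n)%N by nia.
  have -> : (((n - 1) * s).+1 = (n - 1) * (s - 1) + n)%N by nia.
  rewrite !exprD.
  set x1 := ('X + 1) ^+ (n * (m - 1) - 2 * s * (n - 1)).
  set x2 := ('X + 2) ^+ ((n - 1) * (s - 1)).
  by ring.
have -> : 2 * s%:R - 1 = m%:R - 1 :> R by rewrite hm0 natrM.
apply: (spectrum_of_factor sym m1 (c := - (-1) ^+ n)).
- by rewrite oppr_eq0 signr_eq0.
- by rewrite /loose_path_order; nia.
apply: (mulIf w0); rewrite core hm0 subnn muln0 add0n half_overlap_core //.
have -> : (((n - 1) * s).+1 = (n - 1) * (s - 1) + n)%N by nia.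
rewrite exprMn [(- ('X + 1)) ^+ _]exprNn -mul_polyC !polyC_simp.
have -> : (-1) ^+ (n - 2) = (-1) ^+ n :> {poly R}.
  by rewrite -[in RHS](subnK (ltnW hn)) exprD sqrrN expr1n mulr1.
have X1E : ('X + 1) ^+ (2 * s) * ('X + 1) ^+ (n - 2) =
    ('X + 1) ^+ (2 * (s - 1)) * ('X + 1) ^+ n :> {poly R}.
  by rewrite -!exprD; congr (_ ^+ _); lia.
rewrite exprD; move: X1E (half_overlap_polynomial R s n).
move: (('X + 1) ^+ (2 * s)) (('X + 1) ^+ (n - 2)) (('X + 1) ^+ (2 * (s - 1))).
move: (('X + 1) ^+ n) (('X + 2) ^+ n) (('X + 2) ^+ ((n - 1) * (s - 1))) ((-1) ^+ n).
move=> x1n x2n y2 e x1s x1m x1k X1E h.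
transitivity (- (x1s * x1m) * (y2 * x2n * (e * h))); first by ring.
by rewrite X1E; ring.
Qed.
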